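(* Let $\alpha_1 > 0 > \alpha_2$ and $\Delta > 0$ be fixed real numbers. For $\xi \in \mathbb{R}$ let $(x_k^{\xi})_{k \ge 0}$ be the Euler scheme $$x_{k+1}^{\xi} = x_k^{\xi} + a(x_k^{\xi})\,\Delta + W_{(k+1)\Delta} - W_{k\Delta}, \quad k = 0,1,\ldots, \qquad x_0^{\xi} = \xi,$$ where $a(x) = \alpha_1 \cdot \mathbf{1}_{(-\infty,0)}(x) + \alpha_2 \cdot \mathbf{1}_{[0,\infty)}(x)$ for $x \in \mathbb{R}$, and $W$ is a standard one-dimensional Brownian motion. Then this Euler scheme (as a time-homogeneous Markov chain on $\mathbb{R}$) admits a unique stationary distribution $\mu_{\Delta}$, which is independent of the initial value $\xi$. Moreover, there exist $\beta_{\Delta} \in (0,1)$ (not depending on $\xi$) and finite constants $M_{\Delta}(\xi)$, $\xi \in \mathbb{R}$, such that for every $\xi \in \mathbb{R}$ $$\sup_{A \in \mathcal{B}(\mathbb{R})} \left| \mathbb{P}(x_k^{\xi} \in A) - \mu_{\Delta}(A) \right| \le M_{\Delta}(\xi) \cdot \beta_{\Delta}^k, \qquad k \ge 1.$$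
   Context: $(W_t)_{t \ge 0}$ is a standard one-dimensional Brownian motion on a probability space with probability measure $\mathbb{P}$; $\mathcal{B}(\mathbb{R})$ denotes the Borel $\sigma$-algebra of $\mathbb{R}$; the initial value $\xi \in \mathbb{R}$ is deterministic. The Euler scheme is a time-homogeneous Markov chain on $\mathbb{R}$ with transition kernel $$p_{\Delta}(x,A) = \int_A \frac{1}{\sqrt{2\pi\Delta}} \exp\left(-\frac{1}{2\Delta}\big(y - (x + a(x)\Delta)\big)^2\right) dy, \qquad x \in \mathbb{R},\ A \in \mathcal{B}(\mathbb{R}).$$ A stationary distribution is a probability measure $\mu$ on $(\mathbb{R}, \mathcal{B}(\mathbb{R}))$ with $\int_{\mathbb{R}} p_{\Delta}(x,A)\,\mu(dx) = \mu(A)$ for all $A \in \mathcal{B}(\mathbb{R})$. *)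

(* Defs.v *)
From HB Require Import structures.
From mathcomp Require Import all_boot all_order all_algebra.
From mathcomp Require Import all_classical all_reals all_analysis.

Set Implicit Arguments.
Unset Strict Implicit.
Unset Printing Implicit Defensive.

Import Order.TTheory GRing.Theory Num.Theory.
Import numFieldNormedType.Exports.

Local Open Scope classical_set_scope.
Local Open Scope ring_scope.

(** The product rule for a proper subfamily is the instance with [A i = setT]
    off that subfamily. Intended for measurable [X i]. *)
Definition mutually_independent (R : realType) (d : measure_display)
    (T : measurableType d) (P : probability T R) (n : nat)
    (X : 'I_n -> T -> R) : Prop :=
  forall A : 'I_n -> set R, (forall i, measurable (A i)) ->
    P (\bigcap_(i in [set: 'I_n]) (X i @^-1` A i)) =
      (\prod_(i < n) P (X i @^-1` A i))%E.

(** Time is [R], but only the values of [W] at times [t >= 0] are constrained.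
    The second parameter of [normal_prob] is the standard deviation. *)
Record brownian_motion (R : realType) (d : measure_display)
    (T : measurableType d) (P : probability T R)
    (W : R -> {RV P >-> R}) : Prop := BrownianMotion {
  brownian_start : {ae P, forall w, W 0 w = 0} ;
  brownian_independent_increments : forall (n : nat) (t : nat -> R),
    0 <= t 0%N -> (forall i, (i < n)%N -> t i <= t i.+1) ->
    mutually_independent P (fun i : 'I_n => W (t i.+1) \- W (t i)) ;
  brownian_gaussian_increments : forall s t : R, 0 <= s -> s < t ->
    forall A : set R, measurable A ->
      P ((W t \- W s) @^-1` A) = normal_prob 0 (Num.sqrt (t - s)) A ;
  brownian_continuous_paths :
    {ae P, forall w, {within `[0, +oo[, continuous (fun t : R => W t w)}}
}.

Definition drift (R : realType) (alpha1 alpha2 x : R) : R :=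
  alpha1 * \1_(`]-oo, 0[ : set R) x + alpha2 * \1_(`[0, +oo[ : set R) x.

Fixpoint euler_scheme (R : realType) (T : Type) (a : R -> R) (Delta : R)
    (W : R -> T -> R) (xi : R) (k : nat) (w : T) : R :=
  if k is j.+1 then
    let x := euler_scheme a Delta W xi j w in
    x + a x * Delta + (W (j.+1%:R * Delta) w - W (j%:R * Delta) w)
  else xi.

Definition euler_kernel (R : realType) (a : R -> R) (Delta x : R)
    (A : set R) : \bar R :=
  (\int[lebesgue_measure]_(y in A)
    (1 / Num.sqrt (2 * pi * Delta) *
     expR (- (1 / (2 * Delta)) * (y - (x + a x * Delta)) ^+ 2))%:E)%E.

Definition stationary_distribution (R : realType) (p : R -> set R -> \bar R)
    (mu : probability (measurableTypeR R) R) : Prop :=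
  forall A : set R, measurable A -> (\int[mu]_x p x A)%E = mu A.

Lemma euler_kernelE (R : realType) (a : R -> R) (Delta x : R) : 0 < Delta ->
  euler_kernel a Delta x = normal_prob (x + a x * Delta) (Num.sqrt Delta).
Proof.
move=> D0; have s0 : Num.sqrt Delta != 0 by rewrite gt_eqF// sqrtr_gt0.
have E (m y : R) : 1 / Num.sqrt (2 * pi * Delta) *
    expR (- (1 / (2 * Delta)) * (y - m) ^+ 2) =
    normal_pdf m (Num.sqrt Delta) y.
  rewrite (normal_pdfE _ s0) /normal_peak /normal_fun sqr_sqrtr ?ltW//.
  congr (_ * expR _).
  - by rewrite div1r -mulrA mulr_natl [pi * _]mulrC.
  - by rewrite div1r mulr_natl mulNr mulrC mulNr.
by apply/funext => A; apply: eq_integral => y _; rewrite E.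
Qed.

(* Main.v *)
Require Import Defs.
From HB Require Import structures.
From mathcomp Require Import all_boot all_order all_algebra.
From mathcomp Require Import all_classical all_reals all_analysis.
From mathcomp Require Import measurable_realfun ring lra.

(** The increments [W ((k + 1) Delta) - W (k Delta)] are independent and
    N(0, Delta), so the Euler scheme is a Markov chain whose transition kernel
    is [x |-> N(x + a x Delta, Delta)], and the law of its [k]-th state is the
    [k]-th iterate of that kernel at [xi] ([random_recursion_kernel_iter],
    [euler_law]). What remains is a statement on that kernel alone, and it
    follows from Harris' theorem ([harris]), for which two facts are needed.

    Drift condition ([euler_drift]). Let [c] be the smaller of [alpha1] and
    [- alpha2] and let [V x = exp (c x) + exp (- c x)]. The drift [a] pushes the
    chain towards 0 at speed at least [c] from both sides, and the Gaussian
    moment generating function turns this into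
    [E V(x_1) <= gamma V(x_0) + K] with [gamma = exp (- c^2 Delta / 2) < 1]: the
    growing exponential loses [c^2 Delta] to the drift and regains only
    [c^2 Delta / 2] from the noise, and the other exponential stays below [K].

    Minorization ([euler_small_set]). On a sublevel set of [V] the mean
    [x + a x Delta] is bounded, and Gaussian densities with bounded means all
    lie above a fixed multiple of a narrower centred Gaussian density, since
    [(y - m)^2 / 2 <= y^2 + m^2].

    Harris' theorem is proved by the argument of Hairer and Mattingly, carried
    out on functions rather than on measures. Call [z] a centre of [phi] with
    radius [M] if [|phi - z| <= M (1 + b V)]. For a well-chosen weight [b], the
    kernel maps functions with radius [M] to functions with radius [alpha M],
    where [alpha < 1] ([harris_contraction]): when [V x + V y] is large the
    drift condition alone makes the difference of the images at [x] and [y]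
    shrink relative to the weight, and otherwise [x] and [y] lie in the small
    set, where the common part of the two transition laws cancels
    ([minorized_gap]). Starting from indicator functions, the [n]-step
    transition probabilities of a set are, uniformly in the set, Cauchy with
    rate [alpha^n] and asymptotically independent of the starting point
    ([iter_cauchy]). A uniform limit of probabilities is a probability
    ([uniform_limit_probability]); this limit is the stationary distribution. *)

Set Implicit Arguments.
Unset Strict Implicit.
Unset Printing Implicit Defensive.

Import Order.TTheory GRing.Theory Num.Theory.
Import numFieldNormedType.Exports.

Local Open Scope classical_set_scope.
Local Open Scope ring_scope.

(** * Comparison of integrals under minorized measures *)

Section minorization.
Context d (T : measurableType d) (R : realType).

Lemma minorized_integral (mu nu : {measure set T -> \bar R}) (eta : R)
    (f : T -> \bar R) :
  0 <= eta -> (forall A, measurable A -> (eta%:E * nu A <= mu A)%E) ->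
  (forall x, (0 <= f x)%E) -> measurable_fun [set: T] f ->
  (eta%:E * \int[nu]_x f x <= \int[mu]_x f x)%E.
Proof.
move=> eta0 numu f0 mf.
rewrite -(ge0_integral_mscale nu measurableT (NngNum eta0))//.
exact: ge0_le_measure_integral.
Qed.

(** Both [M psi - phi] and [M psi + phi] are nonnegative. Bounding the integral
    of the first for [mu1], and of the second for [mu2], below by [eta] times
    the integral for [nu], and adding, removes [phi] from the [nu]-side and
    leaves [2 eta M] times the integral of [psi], which is at least
    [2 eta M]. *)
Lemma minorized_gap (mu1 mu2 nu : {measure set T -> \bar R}) (eta M : R)
    (psi phi : T -> R) :
  0 <= eta -> nu setT = 1%E ->
  (forall A, measurable A -> (eta%:E * nu A <= mu1 A)%E) ->
  (forall A, measurable A -> (eta%:E * nu A <= mu2 A)%E) ->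
  mu1.-integrable setT (EFin \o psi) -> mu2.-integrable setT (EFin \o psi) ->
  measurable_fun [set: T] phi ->
  (forall x, 1 <= psi x) -> 0 <= M -> (forall x, `|phi x| <= M * psi x) ->
  \int[mu1]_x phi x - \int[mu2]_x phi x <=
    M * (\int[mu1]_x psi x + \int[mu2]_x psi x - 2 * eta).
Proof.
move=> eta0 nu1 num1 num2 ip1 ip2 mphi psi1 M0 phiM.
have mpsi : measurable_fun [set: T] psi.
  by apply/measurable_EFinP; case/integrableP: ip1.
have iphi (mu : {measure set T -> \bar R}) :
    mu.-integrable setT (EFin \o psi) -> mu.-integrable setT (EFin \o phi).
  move=> ip; apply: (le_integrable _ _ _ (integrableZl measurableT M ip)) => //.
    exact/measurable_EFinP.
  by move=> x _ /=; rewrite lee_fin (le_trans (phiM x))// ler_norm.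
have iM (mu : {measure set T -> \bar R}) :
    mu.-integrable setT (EFin \o psi) ->
    mu.-integrable setT (EFin \o (fun x => M * psi x)).
  by move=> ip; exact: (integrableZl measurableT M ip).
pose f1 x := M * psi x - phi x; pose f2 x := M * psi x + phi x.
have f10 x : 0 <= f1 x by rewrite subr_ge0 (le_trans (ler_norm _)).
have f20 x : 0 <= f2 x.
  by rewrite -lerBlDr sub0r (le_trans (ler_norm _))// normrN.
have mf1 : measurable_fun [set: T] f1.
  by apply: measurable_funB => //; exact: measurable_funM.
have mf2 : measurable_fun [set: T] f2.
  by apply: measurable_funD => //; exact: measurable_funM.
have if1 : mu1.-integrable setT (EFin \o f1).
  by apply: (integrableB measurableT (iM _ ip1) (iphi _ ip1)).
have if2 : mu2.-integrable setT (EFin \o f2).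
  by apply: (integrableD measurableT (iM _ ip2) (iphi _ ip2)).
have H1 := minorized_integral eta0 num1 (f := EFin \o f1) f10
  ltac:(exact/measurable_EFinP).
have H2 := minorized_integral eta0 num2 (f := EFin \o f2) f20
  ltac:(exact/measurable_EFinP).
have : ((2 * M * eta)%:E <= (\int[mu1]_x f1 x)%:E + (\int[mu2]_x f2 x)%:E)%E.
  rewrite /Rintegral !fineK; last 2 first.
  - exact: integrable_fin_num if2.
  - exact: integrable_fin_num if1.
  apply: le_trans (leeD H1 H2).
  rewrite -ge0_muleDr; last 2 first.
  - by apply: integral_ge0 => x _; rewrite lee_fin.
  - by apply: integral_ge0 => x _; rewrite lee_fin.
  rewrite -ge0_integralD//; last 4 first.
  - by move=> x _; rewrite lee_fin.
  - exact/measurable_EFinP.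
  - by move=> x _; rewrite lee_fin.
  - exact/measurable_EFinP.
  rewrite mulrC EFinM; apply: lee_wpmul2l; first by rewrite lee_fin.
  apply: (@le_trans _ _ (\int[nu]_x (2 * M)%:E)%E).
    by rewrite integral_cst// nu1 mule1.
  apply: ge0_le_integral => //.
  - by move=> x _; rewrite lee_fin mulr_ge0.
  - by apply/measurable_EFinP/measurable_funD.
  - move=> x _; rewrite /f1 /f2 /= lee_fin; have := psi1 x.
    move: M0; clear; nra.
rewrite -EFinD lee_fin /f1 /f2.
rewrite RintegralB ?RintegralD//;
  [|exact: iM|exact: iphi|exact: iM|exact: iphi].
rewrite !RintegralZl//; lra.
Qed.

(** The centre is the supremum of [g - M psi]: the hypothesis says that every
    value of [g - M psi] is below every value of [g + M psi]. *)
Lemma oscillation_center (psi g : T -> R) (M : R) :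
  (forall x y, g x - g y <= M * (psi x + psi y)) ->
  exists c, forall x, `|g x - c| <= M * psi x.
Proof.
move=> osc; pose E := range (fun x => g x - M * psi x).
have ubE x : ubound E (g x + M * psi x).
  by move=> _ [y _ <-]; have := osc y x; lra.
have supE : has_sup E.
  split; first by exists (g point - M * psi point); exists point.
  by exists (g point + M * psi point).
exists (sup E) => x.
have H1 : g x - M * psi x <= sup E.
  by apply: ub_le_sup; [exact: supE.2 | exists x].
have H2 : sup E <= g x + M * psi x.
  by apply: ge_sup; [exact: supE.1|exact: ubE].
rewrite ler_norml; lra.
Qed.

End minorization.

(** * Iterates of a Markov kernel *)

Section iterates.
Context d (T : measurableType d) (R : realType).

Fixpoint kernel_iter (p : R.-pker T ~> T) (n : nat) : R.-spker T ~> T :=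
  if n is m.+1 then mkcomp_noparam p (kernel_iter p m)
  else kdirac (@measurable_id _ T setT).

Variable p : R.-pker T ~> T.

Lemma kernel_iterS n x A :
  kernel_iter p n.+1 x A = (\int[p x]_y kernel_iter p n y A)%E.
Proof. by []. Qed.

Lemma kernel_iter_setT n x : kernel_iter p n x setT = 1%E.
Proof.
elim: n x => [|n IH] x; first by rewrite /= diracT.
rewrite kernel_iterS (eq_integral _ _ (fun y _ => IH y)).
by rewrite integral_cst//= prob_kernel mule1.
Qed.

(** [integral_kcomp] composes with a kernel on a product space; [kernel_snd] is
    the kernel that ignores the first component. *)
Lemma integral_kernel_iterS n x (f : T -> \bar R) : (forall y, (0 <= f y)%E) ->
  measurable_fun [set: T] f ->
  (\int[kernel_iter p n.+1 x]_y f y =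
   \int[p x]_y \int[kernel_iter p n y]_z f z)%E.
Proof.
move=> f0 mf.
exact: (integral_kcomp p (kernel.kernel_snd (kernel_iter p n)) x f0 mf).
Qed.

Lemma kernel_iterSr n x A : measurable A ->
  kernel_iter p n.+1 x A = (\int[kernel_iter p n x]_y p y A)%E.
Proof.
move=> mA; elim: n x => [|n IH] x.
  rewrite kernel_iterS/= integral_dirac//; last exact: measurable_kernel.
  rewrite diracT mul1e; transitivity (\int[p x]_y (\1_A y)%:E)%E => //.
  by rewrite integral_indic// setIT.
rewrite kernel_iterS (eq_integral _ _ (fun y _ => IH y)).
by rewrite integral_kernel_iterS//; exact: measurable_kernel.
Qed.

Lemma measurable_kernel_iter_fine n A : measurable A ->
  measurable_fun [set: T] (fun x => fine (kernel_iter p n x A)).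
Proof.
by move=> mA; apply: measurableT_comp => //; exact: measurable_kernel.
Qed.

Lemma kernel_iter_fin n x A : measurable A -> kernel_iter p n x A \is a fin_num.
Proof. by move=> mA; exact: finite_kernel_measure. Qed.

Lemma kernel_iter_le1 n x A : measurable A -> fine (kernel_iter p n x A) <= 1.
Proof.
move=> mA; rewrite -lee_fin fineK ?kernel_iter_fin//.
by rewrite -(kernel_iter_setT n x); apply: le_measure; rewrite ?inE.
Qed.

Lemma kernel_iterS_fine n x A : measurable A ->
  fine (kernel_iter p n.+1 x A) = \int[p x]_y fine (kernel_iter p n y A).
Proof.
move=> mA; rewrite kernel_iterS /Rintegral; congr fine.
by apply: eq_integral => y _; rewrite fineK// kernel_iter_fin.
Qed.

Lemma stationary_integral (mu : probability T R) (f : T -> \bar R) :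
  (forall A, measurable A -> (\int[mu]_x p x A)%E = mu A) ->
  (forall x, (0 <= f x)%E) -> measurable_fun [set: T] f ->
  (\int[mu]_x \int[p x]_y f y = \int[mu]_x f x)%E.
Proof.
move=> stat f0 mf.
(* [mu] as a kernel from a point, so that the integral of [p] against [mu]
   becomes a composition of kernels. *)
pose l := kprobability (@measurable_cst _ _ unit (pprobability T R) setT mu).
have := integral_kcomp l (kernel.kernel_snd p) tt f0 mf.
move=> /= <-; apply: eq_measure_integral => A mA _.
exact: stat.
Qed.

End iterates.

(** * Limits of probability measures *)

Section mass_one.
Context d (T : measurableType d) (R : realType).
Variables (Q : {measure set T -> \bar R}) (QT : Q setT = 1%E).

(** [Q] itself; the argument carries the proof that makes it a probability. *)
Definition mass_one of Q setT = 1%E : set T -> \bar R := Q.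

HB.instance Definition _ := Measure.copy (mass_one QT) Q.
HB.instance Definition _ := @Measure_isProbability.Build _ _ _ (mass_one QT) QT.

End mass_one.

Section uniform_limit.
Context d (T : measurableType d) (R : realType).

(** Finite additivity passes to the limit, and countable additivity does because
    the convergence is uniform over sets: the tail of a disjoint union is small
    for one [mu_ k], hence for the limit up to [2 e k]. *)
Lemma uniform_limit_probability (mu_ : nat -> {measure set T -> \bar R})
    (e : nat -> R) :
  (forall n, mu_ n setT = 1%E) ->
  (forall eps, 0 < eps -> exists n, e n <= eps) ->
  (forall n m A, measurable A ->
     `|fine (mu_ (m + n)%N A) - fine (mu_ n A)| <= e n) ->
  exists mu : probability T R, forall n A, measurable A ->
    `|fine (mu A) - fine (mu_ n A)| <= e n.
Proof.
move=> mu1 e0 cauchy.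
have fin n A : measurable A -> mu_ n A \is a fin_num.
  move=> mA; rewrite ge0_fin_numE//; apply: le_lt_trans (ltry 1).
  by rewrite -(mu1 n); apply: le_measure; rewrite ?inE.
(* The intervals of radius [e n] around [mu_ n A] pairwise meet, and the
   supremum of their left ends lies in all of them. The maximum with 0 only
   matters for sets that are not measurable. *)
pose lower A := range (fun n => fine (mu_ n A) - e n).
pose m A := Num.max 0 (sup (lower A)).
have mE n A : measurable A -> `|m A - fine (mu_ n A)| <= e n.
  move=> mA.
  have ubE k : ubound (lower A) (fine (mu_ k A) + e k).
    move=> _ [j _ <-]; have [jk|/ltnW jk] := leqP j k.
      have := cauchy j (k - j)%N A mA; rewrite subnK// ler_norml => /andP[? ?].
      by have := cauchy k 0%N A mA; rewrite add0n subrr normr0; lra.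
    have := cauchy k (j - k)%N A mA; rewrite subnK// ler_norml => /andP[? ?].
    by have := cauchy j 0%N A mA; rewrite add0n subrr normr0; lra.
  have supE : has_sup (lower A).
    split; first by exists (fine (mu_ 0%N A) - e 0%N); exists 0%N.
    by exists (fine (mu_ n A) + e n).
  have lo k : fine (mu_ k A) - e k <= sup (lower A).
    by apply: ub_le_sup; [exact: supE.2|exists k].
  have hi : sup (lower A) <= fine (mu_ n A) + e n.
    by apply: ge_sup; [exact: supE.1|exact: ubE].
  have ge0 : 0 <= sup (lower A).
    apply/ler_addgt0Pl => eps /e0[k ek]; have := lo k.
    have : 0 <= fine (mu_ k A) by exact: fine_ge0.
    lra.
  by rewrite /m max_r// ler_norml; have := lo n; lra.
have m_unique A v : measurable A ->
    (forall n, `|v - fine (mu_ n A)| <= e n) -> m A = v.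
  move=> mA H; apply/eqP; rewrite -subr_eq0 -normr_le0.
  apply/ler_addgt0Pl => eps eps0; have [|k ek] := e0 (eps / 2); first lra.
  have := H k; have := mE k A mA; rewrite addr0 !ler_norml.
  by move=> /andP[? ?] /andP[? ?]; apply/andP; split; lra.
have e_ge0 n : 0 <= e n.
  by apply: le_trans (cauchy n 0%N set0 measurable0); rewrite normr_ge0.
have m0 : m set0 = 0.
  by apply: m_unique => // n; rewrite measure0 subr0 normr0.
have mT : m setT = 1.
  by apply: m_unique => // n; rewrite mu1 subrr normr0.
have mU A B : measurable A -> measurable B -> A `&` B = set0 ->
    m (A `|` B) = m A + m B.
  move=> mA mB AB; apply/eqP; rewrite -subr_eq0 -normr_le0.
  apply/ler_addgt0Pl => eps eps0; have [|k ek] := e0 (eps / 3); first lra.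
  have := mE k _ (measurableU _ _ mA mB); rewrite measureU// fineD ?fin//.
  have := mE k _ mA; have := mE k _ mB; rewrite addr0 !ler_norml.
  by move=> /andP[? ?] /andP[? ?] /andP[? ?]; apply/andP; split; lra.
pose M A := (m A)%:E.
have M0 : M set0 = 0%E by rewrite /M m0.
have Mge0 A : (0 <= M A)%E by rewrite lee_fin le_max lexx.
have Msa : semi_sigma_additive M.
  move=> F mF tF mUF.
  pose U n := \big[setU/set0]_(0 <= i < n) F i.
  have mUn n : measurable (U n) by apply: bigsetU_measurable.
  have US n : U n.+1 = U n `|` F n by rewrite /U big_nat_recr.
  have UF n : U n `&` F n = set0.
    rewrite /U big_mkord (@trivIset_bigsetUI _ xpredT)//.
    by rewrite [X in trivIset X F](_ : _ = [set: nat])//; exact/seteqP.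
  have sumE n : (\sum_(0 <= i < n) M (F i))%E = (m (U n))%:E.
    elim: n => [|n IH]; first by rewrite /U !big_nil m0.
    by rewrite big_nat_recr//= IH US mU.
  under eq_fun do rewrite sumE.
  apply: cvg_EFin; first by near=> n.
  apply/cvgrPdist_le => eps eps0.
  have [|k ek] := e0 (eps / 4); first lra.
  have : fine (mu_ k (U n)) @[n --> \oo] --> fine (mu_ k (\bigcup_n F n)).
    apply: fine_cvg; rewrite fineK ?fin//.
    have kE n : (\sum_(0 <= i < n) mu_ k (F i))%E = mu_ k (U n).
      elim: n => [|n IH]; first by rewrite /U !big_nil measure0.
      by rewrite big_nat_recr//= IH US measureU.
    have := @measure_semi_sigma_additive _ _ _ (mu_ k) F mF tF mUF.
    by under eq_fun do rewrite kE.
  move/cvgrPdist_le => /(_ (eps / 2)); have -> : 0 < eps / 2 by lra.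
  move=> /(_ isT); apply: filterS => n /=.
  have := mE k _ mUF; have := mE k _ (mUn n); rewrite !ler_norml.
  by move=> /andP[? ?] /andP[? ?] /andP[? ?]; apply/andP; split; lra.
pose H1 := isMeasure.Build d T R M M0 Mge0 Msa.
pose mu : {measure set T -> \bar R} :=
  HB.pack_for {measure set T -> \bar R} M H1.
have muT : mu setT = 1%E by rewrite /mu/= /M mT.
by exists (mass_one muT) => n A mA; exact: mE.
Unshelve. all: by end_near. Qed.

(** By the layer-cake formula the integral of [f] is the Lebesgue integral over
    [r >= 0] of the mass of [f > r], which converges for each [r] and vanishes
    for [r > 1], so dominated convergence applies. *)
Lemma setwise_cvg_integral (mu_ : nat -> {measure set T -> \bar R})
    (mu : {measure set T -> \bar R}) (f : T -> R) :
  (forall n, mu_ n setT = 1%E) -> mu setT = 1%E ->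
  measurable_fun [set: T] f -> (forall x, 0 <= f x <= 1) ->
  (forall A, measurable A -> mu_ n A @[n --> \oo] --> mu A) ->
  (\int[mu_ n]_x (f x)%:E)%E @[n --> \oo] --> (\int[mu]_x (f x)%:E)%E.
Proof.
move=> mu_1 mu1 mf f01 cvgmu.
pose X := mfun_Sub (mem_set mf).
have layer (Q : {measure set T -> \bar R}) : Q setT = 1%E ->
    measurable_fun [set: R] (fun r => Q (f @^-1` `]r, +oo[)) /\
    (\int[Q]_x (f x)%:E =
     \int[lebesgue_measure]_(r in `[0%R, +oo[) Q (f @^-1` `]r, +oo[))%E.
  move=> QT; pose P : probability T R := mass_one QT.
  split; first exact: (@ccdf_measurable _ _ _ P X).
  have := @ge0_expectation_ccdf _ _ _ P X (fun x => (andP (f01 x)).1).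
  by rewrite unlock.
have mray r : measurable (f @^-1` `]r, +oo[).
  by apply: (measurable_funPTI X); exact: measurable_itv.
rewrite (layer _ mu1).2; under eq_fun do rewrite (layer _ (mu_1 _)).2.
have := @dominated_cvg _ _ _
  (lebesgue_measure : {measure set (measurableTypeR R) -> \bar R})
  `[0%R, +oo[ _ (fun n r => mu_ n (f @^-1` `]r, +oo[))
  (fun r => mu (f @^-1` `]r, +oo[)) (fun r => (\1_(`[0%R, 1%R]) r)%:E).
apply => //.
- move=> n; apply: measurable_funTS; exact: (layer _ (mu_1 n)).1.
- by move=> r _; exact: cvgmu.
- by apply: (integrableS measurableT) => //; exact: integrable_indic_itv.
- move=> n r; rewrite /= in_itv/= andbT => r0.
  rewrite gee0_abs//= indicE mem_setE in_itv/= r0/=.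
  have [r1|r1] := leP r 1.
    by rewrite -(mu_1 n); apply: le_measure; rewrite ?inE.
  rewrite (_ : _ @^-1` _ = set0) ?measure0// -subset0 => x/=.
  rewrite in_itv/= andbT => rf; have /andP[_] := f01 x.
  by rewrite leNgt (lt_trans r1).
Qed.

End uniform_limit.

(** * Contraction in the weighted seminorm *)

(** In the application [t] is [b (V x + V y)]. The first bound serves for two
    points of the small set, where the constant is [2] plus [eta] from the drift
    condition minus [2 eta] from the minorization. The second serves beyond the
    small set, where the factor [(1 + gamma) / 2] instead of [gamma] absorbs the
    additive constant of the drift condition. *)
Lemma contraction_rate (R : realType) (gamma eta t0 : R) :
  0 <= gamma < 1 -> 0 < eta -> 0 < t0 ->
  exists2 alpha, 0 < alpha < 1 & forall t, 0 <= t ->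
    2 - eta + gamma * t <= alpha * (2 + t) /\
    (t0 <= t -> 2 + (1 + gamma) / 2 * t <= alpha * (2 + t)).
Proof.
move=> /andP[g0 g1] eta0 t00.
have t02 : 0 < 2 + t0 by lra.
pose delta := (1 - gamma) / 2 * (t0 / (2 + t0)).
have q0 : 0 < t0 / (2 + t0) by rewrite divr_gt0.
have q1 : t0 / (2 + t0) < 1 by rewrite ltr_pdivrMr//; lra.
have delta0 : 0 < delta by rewrite mulr_gt0//; lra.
(* The term [1 / 2] keeps [alpha] positive. *)
pose alpha := Num.max (1 - eta / 2)
  (Num.max gamma (Num.max (1 - delta) (1 / 2))).
have a1 : 1 - eta / 2 <= alpha by rewrite le_max lexx.
have a2 : gamma <= alpha by rewrite !le_max lexx orbT.
have a3 : 1 - delta <= alpha by rewrite !le_max lexx !orbT.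
have a4 : 1 / 2 <= alpha by rewrite !le_max lexx !orbT.
exists alpha.
  by apply/andP; split; [lra|rewrite !gt_max; apply/and4P; split; lra].
move=> t tge0; split; first by nra.
move=> t0t; have : delta * (2 + t) <= (1 - gamma) / 2 * t.
  rewrite /delta -mulrA; apply: ler_wpM2l; first lra.
  by rewrite mulrAC ler_pdivrMr//; nra.
nra.
Qed.

Section harris.
Context d (T : measurableType d) (R : realType).
(* The radius [4 K / (1 - gamma)] of the small set is such that, outside it, the
   additive constant [2 K] of two drift conditions is at most half of what the
   factor [gamma] gains. *)
Variables (p : R.-pker T ~> T) (V : T -> R) (gamma K eta : R)
  (nu : {measure set T -> \bar R}).
Hypotheses (mV : measurable_fun [set: T] V) (V0 : forall x, 0 <= V x)
  (gamma01 : 0 <= gamma < 1) (K0 : 0 < K) (eta0 : 0 < eta)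
  (nu1 : nu setT = 1%E)
  (drift_cond : forall x,
    (\int[p x]_y (V y)%:E <= (gamma * V x + K)%:E)%E)
  (minor : forall x, V x <= 4 * K / (1 - gamma) ->
     forall A, measurable A -> (eta%:E * nu A <= p x A)%E).

(* With this weight the constant [2 b K] of the drift condition equals [eta],
   half of the gain [2 eta] of the minorization. *)
Let b := eta / (2 * K).
Let psi x := 1 + b * V x.

Let b0 : 0 < b. Proof. by rewrite divr_gt0// mulr_gt0. Qed.

Let psi1 x : 1 <= psi x.
Proof. by rewrite lerDl mulr_ge0// ltW. Qed.

Let iV x : (p x).-integrable setT (EFin \o V).
Proof.
apply/integrableP; split; first exact/measurable_EFinP.
under eq_integral do rewrite /= ger0_norm//.
by rewrite (le_lt_trans (drift_cond x))// ltry.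
Qed.

Let icst x (c : R) : (p x).-integrable setT (EFin \o cst c).
Proof.
apply/integrableP; split; first exact/measurable_EFinP.
under eq_integral do rewrite /=.
by rewrite integral_cst//= prob_kernel mule1 ltry.
Qed.

Let ipsi x : (p x).-integrable setT (EFin \o psi).
Proof.
exact: (integrableD measurableT (icst x 1) (integrableZl measurableT b (iV x))).
Qed.

Let Ipsi x : \int[p x]_y psi y <= 1 + b * (gamma * V x + K).
Proof.
rewrite RintegralD//; last 2 first.
- exact: icst.
- exact: (integrableZl measurableT b (iV x)).
rewrite RintegralZl// Rintegral_cst// prob_kernel mul1r lerD2l.
rewrite ler_pM2l// -lee_fin fineK//; exact: integrable_fin_num.
Qed.

Let iphi x (phi : T -> R) c M : measurable_fun [set: T] phi ->
  (forall y, `|phi y - c| <= M * psi y) -> (p x).-integrable setT (EFin \o phi).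
Proof.
move=> mphi phiM.
have iM := integrableD measurableT (integrableZl measurableT M (ipsi x))
  (icst x `|c|).
apply: (le_integrable _ _ _ iM) => //; first exact/measurable_EFinP.
move=> y _ /=; rewrite lee_fin.
apply: le_trans (ler_norm _).
by rewrite -[phi y](subrK c) (le_trans (ler_normD _ _))// lerD2r.
Qed.

Lemma harris_contraction : exists2 alpha, 0 < alpha < 1 &
  forall (phi : T -> R) c M, measurable_fun [set: T] phi -> 0 <= M ->
  (forall x, `|phi x - c| <= M * psi x) ->
  exists c', forall x, `|\int[p x]_y phi y - c'| <= alpha * M * psi x.
Proof.
have r0 : 0 < 4 * K / (1 - gamma).
  by rewrite divr_gt0//; [rewrite mulr_gt0|case/andP: gamma01; lra].
have t00 : 0 < b * (4 * K / (1 - gamma)) by rewrite mulr_gt0.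
have [alpha alpha01 H] := contraction_rate gamma01 eta0 t00.
exists alpha => // phi c M mphi M0 phiM.
apply: oscillation_center => x y.
have shift z : \int[p z]_y (phi y - c) = \int[p z]_y phi y - c.
  rewrite RintegralB//; [|exact: iphi phiM|exact: icst].
  by rewrite Rintegral_cst// prob_kernel mulr1.
have -> : \int[p x]_y phi y - \int[p y]_y phi y =
    \int[p x]_y (phi y - c) - \int[p y]_y (phi y - c) by rewrite !shift; ring.
have mphic : measurable_fun [set: T] (fun y => phi y - c).
  exact: measurable_funB.
have S0 : 0 <= b * (V x + V y) by rewrite mulr_ge0 ?addr_ge0// ltW.
have [H1 H2] := H _ S0.
have bK : b * (2 * K) = eta by rewrite /b divfK// gt_eqF// mulr_gt0.
have := Ipsi x; have := Ipsi y; rewrite /psi => Iy Ix.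
have [Sr|Sr] := leP (V x + V y) (4 * K / (1 - gamma)).
  have Vx : V x <= 4 * K / (1 - gamma) by apply: le_trans Sr; rewrite lerDl.
  have Vy : V y <= 4 * K / (1 - gamma) by apply: le_trans Sr; rewrite lerDr.
  apply: le_trans (minorized_gap (ltW eta0) nu1 (minor Vx) (minor Vy)
    (ipsi x) (ipsi y) mphic psi1 M0 phiM) _.
  rewrite [alpha * M]mulrC -mulrA ler_wpM2l// /psi.
  apply: le_trans (_ : 2 - eta + gamma * (b * (V x + V y)) <= _); nra.
(* Outside the small set the minorization is used with constant 0, that is,
   by the triangle inequality. *)
have triv z A : measurable A -> ((0%:E : \bar R) * p x A <= p z A)%E.
  by rewrite mul0e.
apply: le_trans (minorized_gap (lexx 0) (prob_kernel x) (triv x) (triv y)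
    (ipsi x) (ipsi y) mphic psi1 M0 phiM) _.
rewrite [alpha * M]mulrC -mulrA ler_wpM2l// /psi.
have {}H2 := H2 ltac:(by rewrite ler_pM2l// ltW).
apply: le_trans (_ : 2 + (1 + gamma) / 2 * (b * (V x + V y)) <= _); last nra.
have : 2 * K <= (1 - gamma) / 2 * (V x + V y).
  move/ltW: Sr; rewrite ler_pdivrMr; [lra|by case/andP: gamma01; lra].
move/(ler_wpM2l (ltW b0)); nra.
Qed.

(** The centre of the [n]-step probabilities is within [alpha^n psi] of their
    values at every point, which compares two starting points; integrating that
    bound once more against [p x] controls the increment from [n] to [n + 1],
    and the increments are summed as a geometric series. *)
Lemma iter_cauchy : exists2 alpha, 0 < alpha < 1 & exists C : T -> R,
  forall n A, measurable A ->
   (forall x y, `|fine (kernel_iter p n x A) - fine (kernel_iter p n y A)| <=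
      (C x + C y) * alpha ^+ n) /\
   (forall m x, `|fine (kernel_iter p (m + n) x A) -
      fine (kernel_iter p n x A)| <= C x * alpha ^+ n).
Proof.
have [alpha a01 H] := harris_contraction.
exists alpha => //.
have [a0 a1] := andP a01.
pose C x := (psi x + (1 + b * (gamma * V x + K))) / (1 - alpha).
have C0 x : psi x <= C x.
  rewrite /C ler_pdivlMr; last lra.
  have : 0 <= 1 + b * (gamma * V x + K).
    have g0 : 0 <= gamma by case/andP: gamma01.
    by rewrite addr_ge0// mulr_ge0 ?(ltW b0)// addr_ge0 ?(ltW K0)// mulr_ge0.
  have := psi1 x; nra.
have step n A : measurable A ->
    exists c, forall x, `|fine (kernel_iter p n x A) - c| <= alpha ^+ n * psi x.
  move=> mA; elim: n => [|n [c Hc]].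
    exists 0 => x; rewrite subr0 expr0 mul1r (le_trans _ (psi1 x))//.
    by rewrite ger0_norm ?fine_ge0// kernel_iter_le1.
  have an : 0 <= alpha ^+ n by rewrite exprn_ge0// ltW.
  have [c' Hc'] := H _ _ _ (measurable_kernel_iter_fine p n mA) an Hc.
  by exists c' => x; rewrite kernel_iterS_fine// exprS.
have incr n A x : measurable A ->
    `|fine (kernel_iter p n.+1 x A) - fine (kernel_iter p n x A)| <=
    (1 - alpha) * C x * alpha ^+ n.
  move=> mA; have [c Hc] := step n A mA.
  rewrite kernel_iterS_fine//.
  have mk := measurable_kernel_iter_fine p n mA.
  have -> : \int[p x]_y fine (kernel_iter p n y A) -
      fine (kernel_iter p n x A) =
      \int[p x]_y (fine (kernel_iter p n y A) - c) -
      (fine (kernel_iter p n x A) - c).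
    rewrite RintegralB//; [|exact: iphi Hc|exact: icst].
    by rewrite Rintegral_cst// prob_kernel mulr1; ring.
  rewrite (le_trans (ler_normB _ _))//.
  have E : (1 - alpha) * C x * alpha ^+ n =
      alpha ^+ n * (1 + b * (gamma * V x + K)) + alpha ^+ n * psi x.
    rewrite /C; field; lra.
  rewrite E lerD//.
  have ic : (p x).-integrable setT
      (EFin \o (fun y => fine (kernel_iter p n y A) - c)).
    by apply: (integrableB measurableT (iphi x mk Hc) (icst x c)).
  rewrite (le_trans (le_normr_Rintegral _ ic))//.
  apply: (@le_trans _ _ (\int[p x]_y (alpha ^+ n * psi y))).
    apply: le_Rintegral => //.
    - exact: (integrable_norm ic).
    - exact: (integrableZl measurableT _ (ipsi x)).
  rewrite RintegralZl//; apply: ler_wpM2l (Ipsi x).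
  by rewrite exprn_ge0// ltW.
exists C => n A mA.
have an : 0 <= alpha ^+ n by rewrite exprn_ge0// ltW.
split.
  move=> x y; have [c Hc] := step n A mA.
  have := Hc x; have := Hc y; have := C0 x; have := C0 y.
  rewrite !ler_norml => ? ? /andP[? ?] /andP[? ?]; apply/andP; split; nra.
move=> m x.
suff : `|fine (kernel_iter p (m + n) x A) - fine (kernel_iter p n x A)| <=
    C x * alpha ^+ n * (1 - alpha ^+ m).
  move=> /le_trans; apply; rewrite ler_piMr//.
    by rewrite mulr_ge0// (le_trans _ (C0 x))// (le_trans _ (psi1 x)).
  by rewrite lerBlDr lerDl exprn_ge0// ltW.
elim: m => [|m IH]; first by rewrite add0n subrr normr0 expr0 subrr mulr0.
have := incr (m + n)%N A x mA; rewrite -addSn => In.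
have -> : C x * alpha ^+ n * (1 - alpha ^+ m.+1) =
  (1 - alpha) * C x * alpha ^+ (m + n) + C x * alpha ^+ n * (1 - alpha ^+ m).
  rewrite exprS exprD; ring.
rewrite (le_trans _ (lerD In IH))//.
by rewrite (le_trans _ (ler_normD _ _))// addrA subrK.
Qed.

(** The stationary distribution is the limit of the [n]-step laws from one
    point; the limit from any other point is the same, which gives
    uniqueness. *)
Theorem harris :
  exists mu : probability T R,
    [/\ forall A, measurable A -> (\int[mu]_x p x A)%E = mu A,
        (forall nu' : probability T R,
          (forall A, measurable A -> (\int[nu']_x p x A)%E = nu' A) ->
          forall A, measurable A -> nu' A = mu A) &
        exists (beta : R) (M : T -> R), 0 < beta < 1 /\
          forall x n A, measurable A ->
            `|fine (kernel_iter p n x A) - fine (mu A)| <= M x * beta ^+ n].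
Proof.
have [alpha a01 [C H]] := iter_cauchy.
have [a0 a1] := andP a01.
have cvg0 (c : R) : (c * alpha ^+ n) @[n --> \oo] --> (0 : R).
  by apply: cvg_geometric; rewrite ger0_norm// ltW.
have [|n m A mA|mu Hmu] := @uniform_limit_probability _ _ _
  (fun n => kernel_iter p n point) (fun n => C point * alpha ^+ n)
  (fun n => kernel_iter_setT p n point).
- move=> eps eps0; have /cvgrPdist_le/(_ _ eps0)[N _ HN] := cvg0 (C point).
  exists N; have := HN N (leqnn N); rewrite /= sub0r normrN.
  exact: le_trans (ler_norm _).
- by have [_] := H n A mA; exact.
have rate x n A : measurable A ->
    `|fine (kernel_iter p n x A) - fine (mu A)| <=
    (C x + 2 * C point) * alpha ^+ n.
  move=> mA; have [/(_ x point) H1 _] := H n A mA; have := Hmu n A mA; move: H1.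
  by rewrite !ler_norml => /andP[? ?] /andP[? ?]; apply/andP; split; lra.
have cvgk x A : measurable A -> kernel_iter p n x A @[n --> \oo] --> mu A.
  move=> mA.
  rewrite -[mu A]fineK ?fin_num_measure//; apply/fine_cvgP; split.
    by near=> n; exact: kernel_iter_fin.
  apply/cvgrPdist_le => eps eps0.
  have /cvgrPdist_le/(_ _ eps0) := cvg0 (C x + 2 * C point).
  apply: filterS => n; rewrite sub0r normrN => Hn.
  by rewrite distrC (le_trans (rate _ _ _ mA))// (le_trans (ler_norm _)).
exists mu; split.
(* The [n + 1]-step probability of [A] is the integral of [p ^~ A] against the
   [n]-step law; both sides converge. *)
- move=> A mA.
  have pfin y : p y A \is a fin_num by exact: finite_kernel_measure.
  have mp : measurable_fun [set: T] (fun y => fine (p y A)).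
    by apply: measurableT_comp => //; exact: measurable_kernel.
  have p01 y : 0 <= fine (p y A) <= 1.
    rewrite fine_ge0//= -lee_fin fineK// -(@prob_kernel _ _ _ _ _ p y).
    by apply: le_measure; rewrite ?inE.
  have := setwise_cvg_integral (kernel_iter_setT p ^~ point)
    (probability_setT mu) mp p01 (cvgk point).
  under eq_fun do under eq_integral do rewrite fineK//.
  under eq_fun do rewrite -kernel_iterSr//.
  under eq_integral do rewrite fineK//.
  move=> cvgS; apply: (cvg_unique _ cvgS) => //.
  have := cvgk point A mA.
  rewrite -(cvg_shiftS (fun n => kernel_iter p n point A)).
  exact.
(* A stationary [nu'] integrates each [n]-step probability of [A] to [nu' A],
   while these converge pointwise to the constant [mu A]. *)
- move=> nu' stat A mA.
  have nuE n : (\int[nu']_x kernel_iter p n x A)%E = nu' A.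
    elim: n => [|n IH].
      transitivity (\int[nu']_x (\1_A x)%:E)%E => //.
      by rewrite integral_indic// setIT.
    rewrite -[RHS]IH; apply: (stationary_integral stat) => //.
    exact: measurable_kernel.
  have : (\int[nu']_x kernel_iter p n x A)%E @[n --> \oo] -->
      (\int[nu']_x cst (mu A) x)%E.
    apply: (@dominated_cvg _ _ _ _ _ _ _ _ (cst 1%E)) => //.
    - by move=> n; exact: measurable_kernel.
    - by move=> x _; exact: cvgk.
    - apply/integrableP; split => //; under eq_integral do rewrite /= normr1.
      by rewrite integral_cst//= probability_setT mule1 ltry.
    - move=> n x _; rewrite gee0_abs// -(kernel_iter_setT p n x).
      by apply: le_measure; rewrite ?inE.
  rewrite integral_cst// [X in (_ * X)%E](_ : _ = 1%E) ?mule1; last first.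
    exact: probability_setT.
  under eq_fun do rewrite nuE.
  by move=> /cvg_lim <-//; rewrite lim_cst.
- exists alpha, (fun x => C x + 2 * C point).
Unshelve. all: by end_near. Qed.

End harris.

(** * Gaussian measures *)

Section normal.
Context (R : realType).
Implicit Types (m s c L : R) (A : set R).
Local Notation lambda := (@lebesgue_measure R).

Lemma lebesgue_measure_shift m A : measurable A ->
  pushforward lambda (+%R m : _ -> measurableTypeR R) A = lambda A.
Proof.
move=> mA; apply/esym/lebesgue_measure_unique => //=.
  exact: measurable_funD.
move=> mshift _ [[a b]] _ <-.
rewrite /pushforward.
have -> : +%R m @^-1` [set` `](a, b).1, (a, b).2]] = `]a - m, b - m]%classic.
  by apply/funext => x; rewrite /preimage/= !in_itv/= ltrBlDl lerBrDl.
rewrite !lebesgue_measure_itv/= !lte_fin ltrD2r; case: ifP => // _.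
by rewrite -!EFinB; congr EFin; ring.
Qed.

Lemma normal_prob_shift m s A : s != 0 -> measurable A ->
  normal_prob 0 s (+%R m @^-1` A) = normal_prob m s A.
Proof.
move=> s0 mA; rewrite /normal_prob.
have mshift : measurable_fun setT
    (+%R m : measurableTypeR R -> measurableTypeR R).
  exact: measurable_funD.
transitivity (\int[lambda]_(x in +%R m @^-1` A)
    ((EFin \o normal_pdf m s) \o (+%R m : _ -> measurableTypeR R)) x)%E.
  apply: eq_integral => x _ /=; congr EFin.
  by rewrite !normal_pdfE// /normal_fun subr0 addrAC subrr add0r.
rewrite -(@ge0_integral_pushforward _ _ _ _ R _ mshift)//.
- by apply: eq_measure_integral => B mB _; exact: lebesgue_measure_shift.
- by apply/measurable_EFinP/measurable_funTS; exact: measurable_normal_pdf.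
- by move=> y _; rewrite lee_fin normal_pdf_ge0.
Qed.

(** The Radon-Nikodym derivative of the Gaussian measure is almost everywhere
    equal to the Gaussian density. *)
Lemma ge0_integral_normal_prob m s (f : R -> R) :
  measurable_fun setT f -> (forall x, 0 <= f x) ->
  (\int[normal_prob m s]_x (f x)%:E =
   \int[lambda]_x (f x * normal_pdf m s x)%:E)%E.
Proof.
move=> mf f0.
have dom := normal_prob_dominates m s.
have mEf : measurable_fun [set: measurableTypeR R] (EFin \o f).
  exact/measurable_EFinP.
rewrite -(Radon_Nikodym_SigmaFinite.change_of_variables
  dom _ measurableT mEf)//.
have mRN := measurable_int _ (Radon_Nikodym_SigmaFinite.f_integrable dom).
have mpdf : measurable_fun [set: measurableTypeR R]
    (fun x => (normal_pdf m s x)%:E).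
  by apply/measurable_EFinP; exact: measurable_normal_pdf.
under [RHS]eq_integral do rewrite EFinM.
apply: ae_eq_integral => //.
- exact: emeasurable_funM.
- exact: emeasurable_funM.
- apply: ae_eqe_mul2l; apply: integral_ae_eq => //.
    exact: Radon_Nikodym_SigmaFinite.f_integrable.
  by move=> B _ mB; rewrite -Radon_Nikodym_SigmaFinite.f_integral.
Qed.

(** Completing the square: [exp (c x)] times the density of mean [m] is a
    constant times the density of mean [m + c s^2]. *)
Lemma normal_mgf m s c : s != 0 ->
  (\int[normal_prob m s]_x (expR (c * x))%:E =
   (expR (c * m + c ^+ 2 * s ^+ 2 / 2))%:E)%E.
Proof.
move=> s0; rewrite ge0_integral_normal_prob//; last first.
  by apply: measurableT_comp => //; exact: measurable_funM.
transitivity (\int[lambda]_x ((expR (c * m + c ^+ 2 * s ^+ 2 / 2))%:E *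
    (normal_pdf (m + c * s ^+ 2) s x)%:E))%E.
  apply: eq_integral => x _; rewrite -EFinM; congr EFin.
  rewrite !normal_pdfE// /normal_fun mulrCA [in RHS]mulrCA; congr (_ * _).
  by rewrite -!expRD; congr expR; field.
rewrite ge0_integralZl//.
- by rewrite integral_normal_pdf mule1.
- by apply/measurable_EFinP; exact: measurable_normal_pdf.
- by move=> x _; rewrite lee_fin normal_pdf_ge0.
Qed.

(** Since [(x - m)^2 / 2 <= x^2 + m^2], the density of mean [m] dominates
    [exp (- L^2 / s^2) exp (- x^2 / s^2)] up to normalization, and the last
    factor is, again up to normalization, the density of variance [s^2 / 2]. *)
Lemma normal_minorization s L : s != 0 -> exists2 eta : R, 0 < eta &
  forall m, `|m| <= L -> forall A, measurable A ->
  (eta%:E * normal_prob 0 (s / Num.sqrt 2) A <= normal_prob m s A)%E.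
Proof.
move=> s0; have t0 : s / Num.sqrt 2 != 0.
  by rewrite mulf_neq0 ?invr_eq0 ?sqrtr_eq0 -?ltNge.
set t := s / _ in t0 *.
have t2 : t ^+ 2 *+ 2 = s ^+ 2.
  rewrite /t exprMn exprVn sqr_sqrtr//.
  by rewrite -[RHS](divfK (_ : (2 : R) != 0))// mulr_natr.
exists (expR (- (L ^+ 2 / s ^+ 2)) * (normal_peak s / normal_peak t)).
  by rewrite mulr_gt0 ?expR_gt0// divr_gt0 ?normal_peak_gt0.
move=> m mL A mA; rewrite /normal_prob -ge0_integralZl//; last 3 first.
- by apply/measurable_EFinP/measurable_funTS; exact: measurable_normal_pdf.
- by move=> x _; rewrite lee_fin normal_pdf_ge0.
- by rewrite lee_fin mulr_ge0 ?expR_ge0// divr_ge0 ?normal_peak_ge0.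
apply: ge0_le_integral => //.
- move=> x _; rewrite -EFinM lee_fin mulr_ge0 ?normal_pdf_ge0//.
  by rewrite mulr_ge0 ?expR_ge0// divr_ge0 ?normal_peak_ge0.
- apply/measurable_EFinP/measurable_funTS; apply: measurable_funM => //.
  exact: measurable_normal_pdf.
- by apply/measurable_EFinP/measurable_funTS; exact: measurable_normal_pdf.
- move=> x _; rewrite -EFinM lee_fin !normal_pdfE// /normal_fun t2.
  have pt : normal_peak t != 0 by rewrite gt_eqF// normal_peak_gt0.
  rewrite [leLHS](_ : _ = normal_peak s *
    (expR (- (L ^+ 2 / s ^+ 2)) * expR (- (x - 0) ^+ 2 / s ^+ 2))); last first.
    by field.
  rewrite ler_wpM2l ?normal_peak_ge0// -expRD ler_expR.
  have s2 : 0 < s ^+ 2 by rewrite exprn_even_gt0.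
  have mL2 : m ^+ 2 <= L ^+ 2.
    by rewrite -real_normK ?num_real// ler_pXn2r ?nnegrE ?(le_trans _ mL).
  rewrite subr0 [leRHS](_ : _ = - ((x - m) ^+ 2 / 2) / s ^+ 2); last first.
    by field.
  rewrite !mulNr -opprD lerN2 -mulrDl ler_pM2r ?invr_gt0//.
  by have := sqr_ge0 (x + m); nra.
Qed.

(** The assumptions on [s] and [m] are arguments so that the kernel structure
    can be attached to the definition. *)
Definition normal_kernel s of s != 0 :=
  fun (m : measurableTypeR R -> measurableTypeR R) of measurable_fun setT m =>
  (fun x => normal_prob (m x) s) :
  measurableTypeR R -> {measure set (measurableTypeR R) -> \bar R}.

Section kernel.
Variables (s : R) (s0 : s != 0) (m : measurableTypeR R -> measurableTypeR R)
  (mm : measurable_fun setT m).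

Let measurable_normal_kernel A : measurable A ->
  measurable_fun setT (normal_kernel s0 mm ^~ A).
Proof.
move=> mA; pose h (xz : measurableTypeR R * measurableTypeR R) := m xz.1 + xz.2.
have mh : measurable_fun setT h.
  by apply: measurable_funD => //; exact: measurableT_comp.
have mB : measurable (h @^-1` A).
  by rewrite -[X in measurable X]setTI; exact: mh.
rewrite [X in measurable_fun _ X](_ : _ =
    normal_prob 0 s \o xsection (h @^-1` A)).
  exact: measurable_fun_xsection.
by apply/funext => x; rewrite /= xsectionE -normal_prob_shift.
Qed.

HB.instance Definition _ := isKernel.Build _ _ _ _ R (normal_kernel s0 mm)
  measurable_normal_kernel.

HB.instance Definition _ := Kernel_isProbability.Build _ _ _ _ R
  (normal_kernel s0 mm) (fun x => probability_setT (normal_prob (m x) s)).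

End kernel.
End normal.

(** * Recursions driven by independent noise *)

Section random_recursion.
Context d (T : measurableType d) (R : realType) (P : probability T R)
  dS (S : measurableType dS).
Variables (h : S * measurableTypeR R -> S) (Z : nat -> {RV P >-> R}) (xi : S).
Hypotheses (mh : measurable_fun setT h)
  (indep : forall n, mutually_independent P (fun i : 'I_n => Z i)).

Fixpoint random_recursion (k : nat) (w : T) : S :=
  if k is j.+1 then h (random_recursion j w, Z j w) else xi.

Lemma measurable_random_recursion k : measurable_fun setT (random_recursion k).
Proof.
elim: k => [|k IH]; first exact: measurable_cst.
apply: (measurableT_comp mh (_ : measurable_fun setT (fun w => (_ w, Z k w)))).
exact: measurable_fun_pair.
Qed.

Let X k : {mfun T >-> S} := mfun_Sub (mem_set (measurable_random_recursion k)).

Let future (C : nat -> set R) (k m : nat) :=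
  [set w | forall i, (k <= i < m)%N -> C i (Z i w)].

Let future_nil C m : future C m m = setT.
Proof.
apply/seteqP; split=> // w _ i /andP[mi im].
by move: (leq_ltn_trans mi im); rewrite ltnn.
Qed.

Let future_cons C k m : (k < m)%N ->
  future C k m = (Z k @^-1` C k) `&` future C k.+1 m.
Proof.
move=> km; apply/seteqP; split=> [w H|w [Ck H] i /andP[]].
  split; first by apply: H; rewrite leqnn.
  by move=> i /andP[ki im]; apply: H; rewrite im ltnW.
rewrite leq_eqVlt => /predU1P[<-//|ki im].
by apply: H; rewrite ki.
Qed.

Let measurable_future C k m : (forall i, measurable (C i)) ->
  measurable (future C k m).
Proof.
move=> mC.
rewrite (_ : future C k m =
    \bigcap_(i in [set i | (k <= i < m)%N]) (Z i @^-1` C i)).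
  apply: bigcap_measurableType => i _.
  by apply: (measurable_funPTI (Z i)); exact: mC.
by apply/seteqP; split=> w; rewrite /future /bigcap/=.
Qed.

(* The state at time [k] is independent of the noise from time [k] on. Keeping
   the later noise in the statement is what makes the induction on [k] work:
   mutual independence of the noise is only used for the constant state at
   time 0. *)
Let independent_future k m := (k <= m)%N -> forall C B,
  (forall i, measurable (C i)) -> measurable B ->
  P (X k @^-1` B `&` future C k m) =
  (P (X k @^-1` B) * \prod_(k <= i < m) P (Z i @^-1` C i))%E.

(* Independence is known on rectangles; uniqueness of the product measure
   extends it to every measurable [E], in particular to preimages under [h]. *)
Let joint_law k m : independent_future k m -> (k < m)%N ->
  forall C E, (forall i, measurable (C i)) -> measurable E ->
  P ((fun w => (X k w, Z k w)) @^-1` E `&` future C k.+1 m) =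
  (\prod_(k.+1 <= i < m) P (Z i @^-1` C i) *
   (distribution P (X k) \x distribution P (Z k)) E)%E.
Proof.
move=> Hk km C E mC mE.
have mD := measurable_future k.+1 m mC.
have mpair : measurable_fun setT (fun w => (X k w, Z k w)).
  exact: measurable_fun_pair.
have [q qE] : exists q : {nonneg R},
    (\prod_(k.+1 <= i < m) P (Z i @^-1` C i))%E = (q%:num)%:E.
  have fin i : P (Z i @^-1` C i) \is a fin_num.
    by apply: fin_num_measure; apply: (measurable_funPTI (Z i)).
  have q0 : 0 <= \prod_(k.+1 <= i < m) fine (P (Z i @^-1` C i)).
    by apply: prodr_ge0 => i _; exact: fine_ge0.
  exists (NngNum q0) => /=; rewrite -prodEFin; apply: eq_bigr => i _.
  by rewrite fineK.
transitivity ((mscale q (distribution P (X k)) \x distribution P (Z k)) E)%E.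
  symmetry; apply: (@product_measure_unique _ _ _ _ _ _ _
    (pushforward (mrestr P mD) (fun w => (X k w, Z k w)))) => //.
  move=> A B mA mB.
  rewrite -[LHS]/(P ((fun w => (X k w, Z k w)) @^-1` (A `*` B) `&`
    future C k.+1 m)).
  (* The noise constraint on time [k] is absorbed into the family [C]. *)
  pose C' i := if i == k then B else C i.
  have mC' i : measurable (C' i) by rewrite /C'; case: ifP.
  have C'E i : (k < i)%N -> C' i = C i.
    by rewrite /C'; case: eqP => // ->; rewrite ltnn.
  have fE : future C k.+1 m = future C' k.+1 m.
    apply/seteqP; split=> w H i /andP[ki im].
      by rewrite C'E//; apply: H; rewrite ki.
    by rewrite -C'E//; apply: H; rewrite ki.
  rewrite (_ : _ `&` _ = X k @^-1` A `&` future C' k m).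
    rewrite Hk//; last exact: ltnW.
    rewrite -[RHS]/((q%:num)%:E * P (X k @^-1` A) * P (Z k @^-1` B))%E -qE.
    rewrite big_ltn// {1}/C' eqxx [RHS]muleAC [RHS]muleC; congr (_ * _)%E.
    rewrite [RHS]muleC; congr (_ * _)%E.
    by rewrite !big_nat; apply: eq_bigr => i /andP[ki _]; rewrite C'E.
  rewrite (future_cons C' km) -fE setIA; congr (_ `&` _).
  by rewrite /C' eqxx.
rewrite qE /product_measure1 ge0_integral_mscale//.
exact: measurable_fun_xsection.
Qed.

Let step k m : independent_future k m -> independent_future k k.+1 ->
  independent_future k.+1 m.
Proof.
move=> Hm H1 km C B mC mB.
have mhB : measurable (h @^-1` B).
  by rewrite -[X in measurable X]setTI; exact: mh.
rewrite (joint_law Hm km mC mhB).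
rewrite muleC; congr (_ * _)%E.
have := joint_law H1 (leqnn _) mC mhB.
by rewrite future_nil setIT big_geq// mul1e => <-.
Qed.

Let independent_future_all k m : independent_future k m.
Proof.
elim: k m => [|k IH] m; last exact: step (IH m) (IH k.+1).
move=> _ C B mC mB.
have -> : (\prod_(0 <= i < m) P (Z i @^-1` C i))%E = P (future C 0 m).
  rewrite big_mkord -(indep (fun i : 'I_m => mC i)); congr (P _).
  apply/seteqP; split=> [w H i im|w H i _].
    exact: (H (Ordinal im)).
  by apply: H => /=.
have [xiB|xiB] := pselect (B xi).
  rewrite (_ : X 0 @^-1` B = setT); last by apply/seteqP; split=> w.
  by rewrite setTI probability_setT mul1e.
rewrite (_ : X 0 @^-1` B = set0); last by apply/seteqP; split=> w.
by rewrite set0I measure0 mul0e.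
Qed.

(** The joint law of state and noise at time [k] is a product measure, so the
    law at time [k + 1] is the integral of the one-step probabilities against
    the law at time [k]. *)
Lemma random_recursion_kernel_iter (p : R.-pker S ~> S) :
  (forall k x A, measurable A ->
     p x A = P (Z k @^-1` [set z | A (h (x, z))])) ->
  forall k A, measurable A ->
  P (random_recursion k @^-1` A) = kernel_iter p k xi A.
Proof.
move=> pE; elim=> [|k IH] A mA.
  rewrite /= diracE; case: (boolP (xi \in A)).
    move/set_mem => xiA; rewrite (_ : _ @^-1` _ = setT) ?probability_setT//.
    by apply/seteqP; split=> w.
  move/negP; rewrite inE => xiA; rewrite (_ : _ @^-1` _ = set0) ?measure0//.
  by apply/seteqP; split=> w.
have mhA : measurable (h @^-1` A).
  by rewrite -[X in measurable X]setTI; exact: mh.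
have := joint_law (@independent_future_all k k.+1) (leqnn _)
  (fun=> measurableT) mhA.
rewrite future_nil setIT big_geq// mul1e => /= ->.
rewrite kernel_iterSr// /product_measure1.
transitivity (\int[distribution P (X k)]_x p x A)%E.
  by apply: eq_integral => x _ /=; rewrite (pE k)// xsectionE.
by apply: eq_measure_integral => B mB _; exact: IH.
Qed.

End random_recursion.

(** * The Euler scheme *)

Section euler.
Context (R : realType).
Variables (alpha1 alpha2 Delta : R).
Hypotheses (halpha1 : 0 < alpha1) (halpha2 : alpha2 < 0) (hDelta : 0 < Delta).

Let a := drift alpha1 alpha2.
Let m (x : R) : R := x + a x * Delta.
Let s := Num.sqrt Delta.

Let s0 : s != 0. Proof. by rewrite gt_eqF// sqrtr_gt0. Qed.
Let s2 : s ^+ 2 = Delta. Proof. by rewrite sqr_sqrtr// ltW. Qed.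

Lemma driftE x : a x = if x < 0 then alpha1 else alpha2.
Proof.
rewrite /a /drift !indicE !mem_setE !in_itv/= andbT leNgt.
by case: (x < 0); rewrite ?mulr1 ?mulr0 ?addr0 ?add0r.
Qed.

Let drift_bounded x : `|a x| <= alpha1 - alpha2.
Proof.
have := halpha1; have := halpha2 => ? ?.
by rewrite driftE; case: ifP => _; rewrite ler_norml; lra.
Qed.

Lemma measurable_euler_mean :
  measurable_fun setT (m : measurableTypeR R -> measurableTypeR R).
Proof.
apply: measurable_funD => //; apply: measurable_funM => //.
apply: measurable_funD; apply: measurable_funM => //;
  exact: measurable_indic.
Qed.

Definition euler_pker : R.-pker (measurableTypeR R) ~> (measurableTypeR R) :=
  normal_kernel s0 measurable_euler_mean.

Let c := Num.min alpha1 (- alpha2).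
Let V (x : R) := expR (c * x) + expR (- c * x).

Let c0 : 0 < c. Proof. by rewrite lt_min halpha1 oppr_gt0. Qed.
Let c1 : c <= alpha1. Proof. by rewrite ge_min lexx. Qed.
Let c2 : c <= - alpha2. Proof. by rewrite ge_min lexx orbT. Qed.

Let gamma := expR (- (c ^+ 2 * Delta / 2)).
Let K := expR (c * (alpha1 - alpha2) * Delta + c ^+ 2 * Delta / 2).

(** For [x >= 0] the drift is at most [- c], so [exp (c x)] is multiplied by at
    most [exp (- c^2 Delta + c^2 Delta / 2) = gamma], while the expectation of
    the decreasing exponential is bounded by [K]; for [x < 0] the two
    exponentials exchange their roles. *)
Lemma euler_drift x :
  (\int[euler_pker x]_y (V y)%:E <= (gamma * V x + K)%:E)%E.
Proof.
have mexp (b : R) : measurable_fun setT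
    (fun y : measurableTypeR R => (expR (b * y))%:E).
  apply/measurable_EFinP; apply: measurableT_comp => //; exact: measurable_funM.
under eq_integral do rewrite EFinD.
rewrite ge0_integralD//.
rewrite !normal_mgf// -EFinD lee_fin sqrrN s2 /m driftE.
rewrite /V [gamma * _]mulrDr /gamma -!expRD.
have cD : 0 < c * Delta by rewrite mulr_gt0.
have cc1 : c * Delta * c <= c * Delta * alpha1 by rewrite ler_pM2l.
have cc2 : c * Delta * c <= c * Delta * - alpha2 by rewrite ler_pM2l.
have ca1 : 0 < c * Delta * alpha1 by rewrite mulr_gt0.
have ca2 : 0 < c * Delta * - alpha2 by rewrite mulr_gt0 ?oppr_gt0.
pose u := expR (- (c ^+ 2 * Delta / 2) + c * x).
pose v := expR (- (c ^+ 2 * Delta / 2) + - c * x).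
have u0 : 0 <= u by exact: expR_ge0.
have v0 : 0 <= v by exact: expR_ge0.
rewrite -/u -/v; have [x0|x0] := ltP x 0.
- have cx : c * x <= 0 by rewrite mulr_ge0_le0// ltW.
  have uK : expR (c * (x + alpha1 * Delta) + c ^+ 2 * Delta / 2) <= K.
    by rewrite ler_expR; nra.
  have vv : expR (- c * (x + alpha1 * Delta) + c ^+ 2 * Delta / 2) <= v.
    by rewrite ler_expR; nra.
  lra.
- have cx : 0 <= c * x by rewrite mulr_ge0// ltW.
  have uu : expR (c * (x + alpha2 * Delta) + c ^+ 2 * Delta / 2) <= u.
    by rewrite ler_expR; nra.
  have vK : expR (- c * (x + alpha2 * Delta) + c ^+ 2 * Delta / 2) <= K.
    by rewrite ler_expR; nra.
  lra.
Qed.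

(** Since [c |x| <= V x], the mean of the Gaussian law is bounded on sublevel
    sets of [V]. *)
Lemma euler_small_set (r : R) : exists2 eta : R, 0 < eta &
  forall x : R, V x <= r -> forall A, measurable A ->
  (eta%:E * normal_prob 0 (s / Num.sqrt 2) A <= euler_pker x A)%E.
Proof.
have [eta eta0 H] := normal_minorization (r / c + (alpha1 - alpha2) * Delta) s0.
exists eta => // x Vr A mA; apply: H => //.
have cx : c * `|x| <= r.
  apply: le_trans Vr; rewrite /V.
  have := expR_ge1Dx (c * x); have := expR_ge1Dx (- c * x).
  have := expR_gt0 (c * x); have := expR_gt0 (- c * x).
  by case: (ger0P x) => _ *; lra.
rewrite /m (le_trans (ler_normD _ _))// lerD//.
  by rewrite ler_pdivlMr// mulrC.
by rewrite normrM (ger0_norm (ltW hDelta)) ler_pM2r.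
Qed.

Lemma euler_ergodic : exists mu : probability (measurableTypeR R) R,
  [/\ forall A, measurable A -> (\int[mu]_x euler_pker x A)%E = mu A,
      (forall nu : probability (measurableTypeR R) R,
        (forall A, measurable A -> (\int[nu]_x euler_pker x A)%E = nu A) ->
        forall A, measurable A -> nu A = mu A) &
      exists (beta : R) (M : R -> R), 0 < beta < 1 /\
        forall (x : R) n (A : set R), measurable A ->
          `|fine (kernel_iter euler_pker n x A) - fine (mu A)| <=
          M x * beta ^+ n].
Proof.
have [eta eta0 minor] := euler_small_set (4 * K / (1 - gamma)).
apply: (@harris _ (measurableTypeR R) R euler_pker V gamma K eta
  (normal_prob 0 (s / Num.sqrt 2))) => //.
- apply: measurable_funD; apply: measurableT_comp => //; exact: measurable_funM.
- by move=> x; rewrite addr_ge0// expR_ge0.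
- rewrite expR_ge0 -[ltRHS]expR0 ltr_expR oppr_lt0.
  by rewrite divr_gt0// mulr_gt0// exprn_gt0.
- exact: expR_gt0.
- exact: probability_setT.
- exact: euler_drift.
Qed.

Lemma euler_law d (T : measurableType d) (P : probability T R)
    (W : R -> {RV P >-> R}) (hW : brownian_motion W) xi k A : measurable A ->
  P (euler_scheme a Delta W xi k @^-1` A) = kernel_iter euler_pker k xi A.
Proof.
move=> mA.
pose Z j : {RV P >-> R} := (W (j.+1%:R * Delta) - W (j%:R * Delta))%R.
pose h (xz : measurableTypeR R * measurableTypeR R) := m xz.1 + xz.2.
have mh : measurable_fun setT h.
  apply: measurable_funD => //; apply: measurableT_comp => //.
  exact: measurable_euler_mean.
have eulerE : euler_scheme a Delta W xi k = random_recursion h Z xi k.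
  by apply/funext => w; elim: k => [//|k IH] /=; rewrite IH.
have indep n : mutually_independent P (fun i : 'I_n => Z i).
  apply: (brownian_independent_increments hW (t := fun j => j%:R * Delta)).
    by rewrite mul0r.
  by move=> i _; rewrite ler_pM2r// ler_nat.
rewrite eulerE.
apply: (@random_recursion_kernel_iter _ _ _ P _ (measurableTypeR R)
  h Z xi mh indep) => //.
move=> j x B mB; rewrite /= /normal_kernel -normal_prob_shift//.
have jD : j.+1%:R * Delta - j%:R * Delta = Delta.
  by rewrite -mulrBl -natrB// subSnn mul1r.
have := brownian_gaussian_increments hW
  (s := j%:R * Delta) (t := j.+1%:R * Delta).
rewrite jD => -> //.
- by rewrite mulr_ge0// ltW.
- by rewrite ltr_pM2r// ltr_nat.
have mx : measurable_fun setT
    (+%R (m x) : measurableTypeR R -> measurableTypeR R).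
  exact: measurable_funD.
by have := mx measurableT B mB; rewrite setTI.
Qed.

End euler.

Theorem proposition1 (R : realType) (alpha1 alpha2 Delta : R)
    (halpha1 : 0 < alpha1) (halpha2 : alpha2 < 0) (hDelta : 0 < Delta)
    (d : measure_display) (T : measurableType d) (P : probability T R)
    (W : R -> {RV P >-> R}) (hW : brownian_motion W) :
  let a := drift alpha1 alpha2 in
  exists mu : probability (measurableTypeR R) R,
    [/\ stationary_distribution (euler_kernel a Delta) mu,
        (forall nu : probability (measurableTypeR R) R,
           stationary_distribution (euler_kernel a Delta) nu ->
           forall A : set R, measurable A -> nu A = mu A) &
        exists (beta : R) (M : R -> R),
          (0 < beta < 1) /\
          forall (xi : R) (k : nat), (1 <= k)%N ->
            (ereal_sup [set `|P (euler_scheme a Delta W xi k @^-1` A) - mu A|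
                       | A in (measurable : set (set R))]
             <= (M xi * beta ^+ k)%:E)%E].
Proof.
move=> a.
have kernelE x A :
    euler_kernel a Delta x A = euler_pker alpha1 alpha2 hDelta x A.
  by rewrite euler_kernelE.
have stationaryE (nu : probability (measurableTypeR R) R) :
    stationary_distribution (euler_kernel a Delta) nu <->
    forall A, measurable A ->
      (\int[nu]_x euler_pker alpha1 alpha2 hDelta x A)%E = nu A.
  have intE A : (\int[nu]_x euler_kernel a Delta x A =
      \int[nu]_x euler_pker alpha1 alpha2 hDelta x A)%E.
    by apply: eq_integral => x _; rewrite kernelE.
  by split=> H A mA; [rewrite -intE|rewrite intE]; exact: H.
have [mu [stat uniq [beta [M [beta01 rate]]]]] :=
  euler_ergodic halpha1 halpha2 hDelta.
exists mu; split.
- exact/stationaryE.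
- by move=> nu /stationaryE; exact: uniq.
- exists beta, M; split => // xi k _.
  apply: ge_ereal_sup => _ [A mA <-].
  rewrite (euler_law alpha1 alpha2 hDelta hW)//.
  rewrite -[X in (`|X - _|)%E]fineK; last exact: finite_kernel_measure.
  rewrite -[X in (`|_ - X|)%E]fineK ?fin_num_measure//.
  by rewrite -EFinB abse_EFin lee_fin rate.
Qed.
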